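(* For every integer $k\ge4$, let $n=(2^{k-1}+1)2^{k+2}+3$ and $r=2^{k+3}+3$. Then the graph $X_r$ in $\mathcal{H}(n,2)$ has balanced fractional revival at time $\pi/2^k$.
   Context: The graph $X_r$ in the binary Hamming scheme $\mathcal{H}(n,2)$ has as vertices the binary sequences of length $n$, two being adjacent iff their Hamming distance is exactly $r$. For a graph with adjacency matrix $A$ let $U(t)=e^{-\mathrm{i}tA}$. Balanced fractional revival at time $\tau$ means that there are vertices $a\ne b$ and complex $\alpha,\beta$ with $|\alpha|=|\beta|=1/\sqrt2$ and $U(\tau)\mathbf{e}_a=\alpha\mathbf{e}_a+\beta\mathbf{e}_b$, where $\mathbf{e}_a$ is the standard basis vector indexed by $a$. (In $\mathcal{H}(n,2)$ this is equivalent to $U(\tau)=\alpha I+\beta A_n$ with $A_n$ the adjacency matrix of $X_n$.) *)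

(* Defs.v *)
From HB Require Import structures.
From mathcomp Require Import all_boot all_order all_algebra.
From mathcomp Require Import all_classical all_reals all_analysis.
From mathcomp Require Import complex.
Set Implicit Arguments.
Unset Strict Implicit.
Unset Printing Implicit Defensive.
Import Order.TTheory GRing.Theory Num.Theory.
Import numFieldNormedType.Exports.

Local Open Scope ring_scope.
Local Open Scope complex_scope.
Local Open Scope classical_set_scope.

Definition hamming_dist (n : nat) (x y : n.-tuple bool) : nat :=
  #|[set i : 'I_n | tnth x i != tnth y i]%SET|.

Definition hamming_graph (n r : nat) : rel (n.-tuple bool) :=
  [rel x y | hamming_dist x y == r].

(* Rows and columns are indexed by the vertices through [enum_val]. *)
Definition adjmx (K : numFieldType) (V : finType) (e : rel V) : 'M[K]_#|V| :=
  \matrix_(i, j) (e (enum_val i) (enum_val j))%:R.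

Definition std_basis (K : numFieldType) (V : finType) (a : V) : 'cV[K]_#|V| :=
  delta_mx (enum_rank a) 0.

(* exp(M) = \sum_k M^k / k!, the limit being taken in the normed space
   'M[K]_m. The definition is generic in K because the topology is inferred
   from an abstract numFieldType but not from the concrete type R[i]. *)
Definition expmx (K : numFieldType) (m : nat) (M : 'M[K]_m) : 'M[K]_m :=
  limn (series (fun k : nat => (k`!)%:R^-1 *: M ^+ k)).

Definition transition_mx (R : realType) (V : finType) (e : rel V) (t : R) :
    'M[R[i]]_#|V| :=
  expmx ((- ('i * t%:C)) *: adjmx R[i] e).

(* The modulus on R[i] takes values in R[i], hence the cast of 1 / sqrt 2. *)
Definition balanced_fractional_revival (R : realType) (V : finType)
    (e : rel V) (tau : R) : Prop :=
  exists (a b : V) (alpha beta : R[i]),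
    [/\ a != b,
        `|alpha| = (1 / Num.sqrt 2)%:C,
        `|beta| = (1 / Num.sqrt 2)%:C
      & transition_mx e tau *m std_basis R[i] a =
        alpha *: std_basis R[i] a + beta *: std_basis R[i] b].

(* Main.v *)
(* The characters chi_u of (Z/2)^n diagonalise the adjacency matrix of X_r, with
   eigenvalue K(s), the coefficient of X^r in (1 - X)^s (1 + X)^(n - s), where s
   is the weight of u.  Hence U(pi / 2^k) acts on chi_u by the phase
   exp(- i pi K(s) / 2^k), which only depends on K(s) modulo 2^(k+1).  As
   (1 + X)^2 - (1 - X)^2 = 4 X, the difference K(s) - K(s + 2) is four times a
   coefficient of (1 - X)^s (1 + X)^(n - 2 - s); expanding
   1 - X = (1 + X) - 2 X and applying Kummer's theorem to the binomial
   coefficients that appear shows that it vanishes modulo 2^(k+1).  So the phase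
   depends on the parity of s only.  Moreover
   K(0) - K(1) = 2 C(n - 1, r - 1) is an odd multiple of 2^(k-1), so the two
   phases differ by a factor i or -i.  Then U = alpha I + beta A_n where
   alpha and beta are the half sum and the half difference of the two phases,
   both of modulus 1 / sqrt 2. *)
Require Import Defs.
From mathcomp Require Import all_boot all_order all_algebra.
From mathcomp Require Import all_classical all_reals all_analysis.
From mathcomp Require Import complex.
From mathcomp Require Import zify ring.
Set Implicit Arguments.
Unset Strict Implicit.
Unset Printing Implicit Defensive.
Import Order.TTheory GRing.Theory Num.Theory.
Import numFieldNormedType.Exports.

(** * 2-adic valuations of binomial coefficients *)

(** Legendre's formula with a free cut-off [N]: the three factorials in a binomial coefficient can
    then share one summation range and be compared term by term. *)
Lemma logn_fact_trunc p N n : prime p -> n < p ^ N ->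
  logn p n`! = \sum_(1 <= e < N) n %/ p ^ e.
Proof.
move=> pp hN; rewrite logn_fact //; set M := maxn N n.+1.
have ext B : B <= M -> (forall e, B <= e -> n < p ^ e) ->
    \sum_(1 <= e < B) n %/ p ^ e = \sum_(1 <= e < M) n %/ p ^ e.
  move=> BM hB; case: B BM hB => [|B] BM hB.
    rewrite [LHS]big_geq // big1_seq // => e.
    by rewrite andbC mem_index_iota => _; apply/divn_small/hB.
  rewrite [RHS](big_cat_nat (n := B.+1)) //= [X in _ + X]big1_seq ?addn0 // => e.
  by rewrite mem_index_iota => /andP[_ /andP[eB _]]; apply/divn_small/hB.
rewrite [RHS]ext ?leq_maxl // => [|e Ne]; last first.
  by apply: leq_trans hN _; rewrite leq_exp2l ?prime_gt1.
rewrite ext ?leq_maxr // => e ne.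
by apply: leq_trans (ltn_expl e (prime_gt1 pp)); rewrite ltnW // ltnS ltnW.
Qed.

(* Kummer's theorem: the [e]-th summand is the borrow out of the [e] lowest
   base-[p] digits in the subtraction [n - m]. *)
Lemma logn_bin p N n m : prime p -> m <= n -> n < p ^ N ->
  logn p 'C(n, m) = \sum_(1 <= e < N) (n %% p ^ e < m %% p ^ e).
Proof.
move=> pp mn nN.
have /(congr1 (logn p)) := bin_fact mn.
rewrite !lognM ?muln_gt0 ?fact_gt0 ?bin_gt0 // !(@logn_fact_trunc p N) //;
  try by apply: leq_ltn_trans nN; rewrite ?leq_subr.
rewrite -!big_split /= => h.
(* Adding the quotients to both sides avoids truncated subtraction; termwise, [n %/ p ^ e] is the
   sum of the other two quotients plus the borrow. *)
have {h} : logn p 'C(n, m) + \sum_(1 <= e < N) (m %/ p ^ e + (n - m) %/ p ^ e)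
  = \sum_(1 <= e < N) (n %% p ^ e < m %% p ^ e) +
    \sum_(1 <= e < N) (m %/ p ^ e + (n - m) %/ p ^ e).
  rewrite h -big_split /=; apply: eq_bigr => e _.
  have d0 : 0 < p ^ e by rewrite expn_gt0 prime_gt0.
  have := divn_eq n (p ^ e); have := divn_eq m (p ^ e).
  have := divn_eq (n - m) (p ^ e).
  have := ltn_pmod n d0; have := ltn_pmod m d0; have := ltn_pmod (n - m) d0.
  move: (p ^ e) (n %/ _) (n %% _) (m %/ _) (m %% _) ((n - m) %/ _)
    ((n - m) %% _) => d a a' b b' c c' hc hb ha enm em en.
  have {enm} e1 : a * d + a' = (b + c) * d + (b' + c').
    by rewrite -en mulnDl addnACA -em -enm subnKC.
  by case: ltnP => /= bb; nia.
by move/addIn.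
Qed.

Lemma modn_pow2Dl e K x : e <= K -> x < 2 ^ e -> (2 ^ K + x) %% 2 ^ e = x.
Proof. by move=> eK xe; rewrite -(subnK eK) expnD modnMDl modn_small. Qed.

(** For [k + 4 <= e <= 2 * k + 1] the residues modulo [2 ^ e] are [x < y], which gives [k - 2]
    borrows; the extra term is the possible borrow at [e = 2]. *)
Lemma logn_bin_ge k x y : 4 <= k -> x < y -> x < 2 ^ (k + 4) -> y < 2 ^ (k + 4) ->
  k - 2 + (x %% 4 < y %% 4) <= logn 2 'C(2 ^ (2 * k).+1 + x, y).
Proof.
move=> k4 xy xk yk.
have k4le : k + 4 <= (2 * k).+1 by lia.
have y2k : 2 ^ (k + 4) <= 2 ^ (2 * k).+1 by rewrite leq_exp2l.
rewrite (@logn_bin 2 (2 * k).+2) //; first last.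
- by rewrite [(2 ^ _.+2)%N]expnS; lia.
- by lia.
rewrite (@big_cat_nat _ _ _ (k + 4)) //=; try lia.
rewrite addnC leq_add //.
  rewrite (bigD1_seq 2) //= ?iota_uniq //; last by rewrite mem_index_iota; lia.
  rewrite -[in X in _ < X]/(2 ^ 2) -modnDml.
  have -> : 2 ^ (2 * k).+1 %% 2 ^ 2 = 0.
    by apply/eqP; rewrite -/(dvdn _ _) dvdn_exp2l //; lia.
  by rewrite leq_addr.
rewrite (eq_big_nat _ _ (F2 := fun=> 1)) => [|e /andP[ke eK]].
  by rewrite sum_nat_const_nat; lia.
have ek : 2 ^ (k + 4) <= 2 ^ e by rewrite leq_exp2l.
by rewrite modn_pow2Dl ?modn_small ?xy //; lia.
Qed.

(** The same [k - 2] high borrows occur, and no others: for [e <= k + 2] both residues are those of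
    2, and at [e = k + 3] they are [2 ^ (k + 2) + 2] and 2. *)
Lemma logn_bin_eq k : 4 <= k ->
  logn 2 'C(2 ^ (2 * k).+1 + (2 ^ (k + 2) + 2), 2 ^ (k + 3) + 2) = k - 2.
Proof.
move=> k4.
have a4 : 4 <= 2 ^ (k + 2) by rewrite (@leq_exp2l 2 2) //; lia.
have e3 : 2 ^ (k + 3) = 2 * 2 ^ (k + 2) by rewrite -expnS; congr expn; lia.
have e4 : 2 ^ (k + 4) = 4 * 2 ^ (k + 2) by rewrite -(expnD 2 2); congr expn; lia.
have y2k : 2 ^ (k + 4) <= 2 ^ (2 * k).+1 by rewrite leq_exp2l //; lia.
rewrite (@logn_bin 2 (2 * k).+2) //; first last.
- by rewrite [(2 ^ _.+2)%N]expnS; lia.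
- by lia.
rewrite (@big_cat_nat _ _ _ (k + 4)) //=; try lia.
rewrite big1_seq => [|e]; rewrite ?mem_index_iota.
  rewrite (eq_big_nat _ _ (F2 := fun=> 1)) => [|e /andP[ke eK]].
    by rewrite sum_nat_const_nat; lia.
  have ek : 2 ^ (k + 4) <= 2 ^ e by rewrite leq_exp2l.
  by rewrite modn_pow2Dl ?modn_small; lia.
move=> /andP[_ /andP[e0 ek]].
have [e2|e2] := leqP e (k + 2).
  have h K x : k + 2 <= K -> (2 ^ K + x) %% 2 ^ e = x %% 2 ^ e.
    by move=> kK; rewrite -(@subnK e K) ?expnD ?modnMDl //; lia.
  by rewrite !h ?ltnn //; lia.
have -> : e = k + 3 by lia.
by rewrite modnDl modn_pow2Dl ?modn_small; lia.
Qed.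

(** * Krawtchouk numbers and their divisibility by powers of 2 *)

Local Open Scope ring_scope.

Definition krawtchouk (n r s : nat) : int :=
  ((1 - 'X) ^+ s * (1 + 'X) ^+ (n - s))`_r.

Lemma coef_1DX_exp (R : nzRingType) n r : ((1 + 'X : {poly R}) ^+ n)`_r = 'C(n, r)%:R.
Proof.
rewrite exprDn_comm; last exact: commr_polyX.
under eq_bigr do rewrite expr1n mul1r.
rewrite coef_sum; under eq_bigr do rewrite coefMn coefXn.
have [rn|nr] := leqP r n; last first.
  rewrite bin_small // big1 // => i _.
  by rewrite gtn_eqF ?mul0rn //; apply: leq_trans (ltn_ord i) nr.
rewrite (bigD1 (Ordinal (rn : (r < n.+1)%N))) //= eqxx big1 ?addr0 // => i.
by rewrite eq_sym -val_eqE /= => /negPf ->; rewrite mul0rn.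
Qed.

Lemma krawtchouk_step n r s : (s.+2 <= n)%N ->
  krawtchouk n r.+1 s = krawtchouk n r.+1 s.+2 + 4 * krawtchouk (n - 2) r s.
Proof.
move=> sn; rewrite /krawtchouk.
have -> : (n - s = (n - 2 - s).+2)%N by lia.
have -> : (n - s.+2 = n - 2 - s)%N by lia.
set m := (n - 2 - s)%N.
have -> : (1 - 'X : {poly int}) ^+ s * (1 + 'X) ^+ m.+2 =
  (1 - 'X) ^+ s.+2 * (1 + 'X) ^+ m + 4%:P * ((1 - 'X) ^+ s * (1 + 'X) ^+ m * 'X).
  by rewrite !exprS (_ : 4%:P = 4%:R) -?polyCMn //; ring.
by rewrite coefD coefCM coefMX.
Qed.

(* Expand [1 - 'X = (1 + 'X) - 2 'X] by the binomial theorem. *)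
Lemma krawtchoukE n r s : (s <= n)%N ->
  krawtchouk n r s =
  \sum_(i < s.+1 | (i <= r)%N) (- 2) ^+ i * ('C(n - i, r - i) * 'C(s, i))%:R.
Proof.
move=> sn; rewrite /krawtchouk.
have -> : 1 - 'X = (1 + 'X) + (- 2)%:P * 'X :> {poly int}.
  by rewrite polyCN (_ : 2%:P = 2%:R) -?polyCMn //; ring.
rewrite exprDn mulr_suml coef_sum [RHS]big_mkcond; apply: eq_bigr => i _.
have -> : (1 + 'X) ^+ (s - i) * ((-2)%:P * 'X) ^+ i *+ 'C(s, i) * (1 + 'X) ^+ (n - s) =
   ((-2) ^+ i)%:P * ((1 + 'X) ^+ (n - i) * 'X^i) *+ 'C(s, i) :> {poly int}.
  have -> : (n - i = (s - i) + (n - s))%N by have := ltn_ord i; lia.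
  rewrite exprD exprMn -polyC_exp; move: ((-2) ^+ i)%:P ((1 + 'X) ^+ (s - i))
    ((1 + 'X) ^+ (n - s)) => a b c.
  by rewrite mulrnAl; congr (_ *+ _); ring.
rewrite coefMn coefCM coefMXn coef_1DX_exp ltnNge.
by case: leqP => _ /=; rewrite ?mulr0 ?mul0rn // natrM mulrA [RHS]mulr_natr.
Qed.

Lemma krawtchouk0 n r : krawtchouk n r 0 = 'C(n, r)%:R.
Proof. by rewrite /krawtchouk expr0 mul1r subn0 coef_1DX_exp. Qed.

(** The polynomials (1 + X)^(n + 1) and (1 - X)(1 + X)^n differ by 2 X (1 + X)^n. *)
Lemma krawtchouk1 n r :
  krawtchouk n.+1 r.+1 1 = krawtchouk n.+1 r.+1 0 - 2 * 'C(n, r)%:R.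
Proof.
rewrite krawtchouk0 /krawtchouk expr1 subSS subn0.
rewrite mulrBl mul1r coefB coefXM /= !coef_1DX_exp binS natrD; ring.
Qed.

(** Exhibits the binary digits of the length, as needed to count borrows. *)
Lemma length_expand k : (4 <= k)%N ->
  ((2 ^ (k - 1) + 1) * 2 ^ (k + 2) + 3 =
   2 ^ (2 * k).+1 + (2 ^ (k + 2) + 3))%N.
Proof.
by move=> hk; rewrite mulnDl mul1n -expnD -addnA; congr (2 ^ _ + _)%N; lia.
Qed.

(* For [i = 0] the borrow at binary digit 1 makes up for the absent factor
   [2 ^ i]. *)
Lemma pow2_dvd_bin k n r i : (4 <= k)%N ->
  n = ((2 ^ (k - 1) + 1) * 2 ^ (k + 2) + 3)%N -> r = (2 ^ (k + 3) + 3)%N ->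
  (i <= r.-1)%N -> (2 ^ (k - 1) %| 2 ^ i * 'C(n - 2 - i, r.-1 - i))%N.
Proof.
move=> hk; rewrite length_expand // => nE hr ir.
(* For large [i] the factor [2 ^ i] suffices. Otherwise [i] is below [2 ^ (k + 2)], so subtracting
   it leaves the leading digit of [n - 2] in place. *)
have [ik|ik] := leqP (k - 1) i; first by rewrite dvdn_mulr // dvdn_exp2l.
have e3 : (2 ^ (k + 3) = 2 * 2 ^ (k + 2))%N by rewrite -expnS; congr expn; lia.
have e4 : (2 ^ (k + 4) = 4 * 2 ^ (k + 2))%N by rewrite -(expnD 2 2); congr expn; lia.
have k2 : (k + 2 < 2 ^ (k + 2))%N by rewrite ltn_expl.
have y2k : (2 ^ (k + 4) <= 2 ^ (2 * k).+1)%N by rewrite leq_exp2l //; lia.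
have c0 : (0 < 'C(n - 2 - i, r.-1 - i))%N by rewrite bin_gt0 nE hr; lia.
rewrite pfactor_dvdn ?muln_gt0 ?expn_gt0 // lognM ?expn_gt0 // pfactorK //.
have := @logn_bin_ge k (2 ^ (k + 2) + 1 - i) (2 ^ (k + 3) + 2 - i) hk.
have -> : (2 ^ (2 * k).+1 + (2 ^ (k + 2) + 1 - i) = n - 2 - i)%N by rewrite nE; lia.
have -> : (2 ^ (k + 3) + 2 - i = r.-1 - i)%N by rewrite hr; lia.
move=> /(_ _ _ _)/wrap[||| h]; try by rewrite ?hr; lia.
have [i0|i0] := posnP i; last first.
  apply: (@leq_trans (i + (k - 2))); first by lia.
  by rewrite leq_add2l (leq_trans _ h) ?leq_addr.
have h1 : ((2 ^ (k + 2) + 1 - i) %% 4 < (r.-1 - i) %% 4)%N.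
  rewrite i0 !subn0 hr addn3 /= (_ : (2 ^ (k + 3)).+2 = 2 ^ (k + 3) + 2)%N; last lia.
  rewrite !(@modn_pow2Dl 2) //; lia.
by move: h; rewrite h1; lia.
Qed.

Lemma pow2_dvd_krawtchouk k n r s : (4 <= k)%N ->
  n = ((2 ^ (k - 1) + 1) * 2 ^ (k + 2) + 3)%N -> r = (2 ^ (k + 3) + 3)%N ->
  (s <= n - 2)%N -> ((2 ^ (k - 1))%:Z %| krawtchouk (n - 2) r.-1 s)%Z.
Proof.
move=> hk hn hr sn; rewrite krawtchoukE //; apply: rpred_sum => i ir.
have -> : (-2) ^+ i = (-1) ^+ i * (2 ^ i)%:Z.
  by rewrite exprNn -[(2 ^ i)%:Z]natz natrX.
rewrite natrM -mulrA dvdz_mull // mulrA dvdz_mulr // natz -PoszM.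
exact: pow2_dvd_bin ir.
Qed.

Lemma krawtchouk_parity k n r s : (4 <= k)%N ->
  n = ((2 ^ (k - 1) + 1) * 2 ^ (k + 2) + 3)%N -> r = (2 ^ (k + 3) + 3)%N ->
  (s <= n)%N ->
  ((2 ^ k.+1)%:Z %| krawtchouk n r s - krawtchouk n r (s %% 2))%Z.
Proof.
move=> hk hn hr.
elim/ltn_ind: s => s IH sn; have [s2|s2] := ltnP s 2.
  by rewrite modn_small // subrr dvdz0.
case: s s2 sn IH => [|[|s]] // _ sn IH.
have -> : (s.+2 %% 2 = s %% 2)%N by rewrite -addn2 modnDr.
have rE : r = r.-1.+1 by rewrite hr; lia.
have := krawtchouk_step r.-1 sn; rewrite -rE => h.
have -> : krawtchouk n r s.+2 - krawtchouk n r (s %% 2) =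
  (krawtchouk n r s - krawtchouk n r (s %% 2)) - 4 * krawtchouk (n - 2) r.-1 s.
  by rewrite h; ring.
apply: rpredB; first by apply: IH; lia.
have -> : (2 ^ k.+1)%:Z = 4 * (2 ^ (k - 1))%:Z.
  by rewrite -PoszM -(expnD 2 2); congr (2 ^ _)%:Z; lia.
by apply: dvdz_mul => //; apply: pow2_dvd_krawtchouk hn hr _; lia.
Qed.

Lemma krawtchouk_diff k n r : (4 <= k)%N ->
  n = ((2 ^ (k - 1) + 1) * 2 ^ (k + 2) + 3)%N -> r = (2 ^ (k + 3) + 3)%N ->
  exists q : int,
    krawtchouk n r 0 - krawtchouk n r 1 = (2 ^ (k - 1))%:Z * (2 * q + 1).
Proof.
move=> hk; rewrite length_expand // => nE hr.
have rE : r = (2 ^ (k + 3) + 2).+1 by rewrite hr; lia.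
have nE' : n = (2 ^ (2 * k).+1 + (2 ^ (k + 2) + 2)).+1 by rewrite nE; lia.
rewrite nE' rE krawtchouk1.
have := logn_bin_eq hk; set c := 'C(_, _) => lc.
have c0 : (0 < c)%N.
  rewrite bin_gt0 -ltnS -nE' -rE; rewrite nE' rE.
  have : (2 ^ (k + 3) <= 2 ^ (2 * k).+1)%N by rewrite leq_exp2l //; lia.
  lia.
have [d nd cE] := pfactor_coprime (isT : prime 2) c0.
(* Here [d] is the odd part of the binomial coefficient, whose 2-part is [2 ^ (k - 2)]. *)
exists (d./2)%:Z; move: nd; rewrite coprime2n => od.
have dE : d = (1 + d./2 * 2)%N by rewrite -[LHS]odd_double_half od muln2.
have kE : (2 ^ (k - 1) = 2 * 2 ^ (k - 2))%N by rewrite -expnS; congr (2 ^ _)%N; lia.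
rewrite kE cE lc natrM [in LHS]dE natrD natrM !natz PoszM; ring.
Qed.

(** * Characters of (Z/2)^n and spectral projections *)

Lemma sum_tuple_prod (R : comNzRingType) n (F : 'I_n -> bool -> R) :
  \sum_(x : n.-tuple bool) \prod_i F i (tnth x i) =
  \prod_i (F i false + F i true).
Proof.
under [RHS]eq_bigr do rewrite addrC -big_bool.
rewrite bigA_distr_bigA /=.
rewrite (reindex (fun x : n.-tuple bool => [ffun i => tnth x i])) /=.
  by apply: eq_bigr => x _; apply: eq_bigr => i _; rewrite ffunE.
exists (fun f : {ffun 'I_n -> bool} => [tuple f i | i < n]) => [x _|f _].
  by apply: eq_from_tnth => i; rewrite tnth_mktuple ffunE.
by apply/ffunP => i; rewrite ffunE tnth_mktuple.
Qed.

Lemma hamming_distE n (x y : n.-tuple bool) :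
  hamming_dist x y = (\sum_(i < n) (tnth x i != tnth y i))%N.
Proof.
rewrite /hamming_dist -sum1dep_card big_mkcond; apply: eq_bigr => i _.
by case: (_ != _).
Qed.

Definition hweight n (u : n.-tuple bool) : nat := (\sum_(i < n) tnth u i)%N.

Lemma hweight_le n (u : n.-tuple bool) : (hweight u <= n)%N.
Proof.
rewrite -[leqRHS]card_ord -sum1_card; apply: leq_sum => i _.
by case: (tnth u i).
Qed.

(** Integer values let the eigenvalue identities be proved in [int] and cast afterwards into any
    field. *)
Definition hchar n (u x : n.-tuple bool) : int :=
  \prod_(i < n) (-1) ^+ (tnth u i && tnth x i).

(** All [r] are treated at once by a generating function in X, which factors over coordinates: up to
    the character value at [y], each coordinate gives 1 - X if [u] is 1 there and 1 + X
    otherwise. *)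
Lemma hchar_eigen n r (u y : n.-tuple bool) :
  \sum_x (hamming_dist y x == r)%:R * hchar u x =
  krawtchouk n r (hweight u) * hchar u y.
Proof.
have genfun : \sum_x 'X^(hamming_dist y x) * (hchar u x)%:P =
    ((1 - 'X) ^+ hweight u * (1 + 'X) ^+ (n - hweight u)) * (hchar u y)%:P
      :> {poly int}.
  under eq_bigr do rewrite hamming_distE -prodrXr rmorph_prod -big_split /=.
  rewrite (sum_tuple_prod (fun i b =>
    'X^(tnth y i != b) * ((-1) ^+ (tnth u i && b))%:P)).
  have -> : (n - hweight u)%N = (\sum_(i < n) ~~ tnth u i)%N.
    have -> : (n - hweight u = \sum_(i < n) 1 - hweight u)%N by rewrite sum1_card card_ord.
    rewrite /hweight -sumnB => [|i _]; last by case: (tnth _ _).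
    by apply: eq_bigr => i _; case: (tnth _ _).
  rewrite /hweight -!prodrXr rmorph_prod -!big_split /=; apply: eq_bigr => i _.
  by case: (tnth _ _); case: (tnth _ _); rewrite /= ?expr0 ?expr1 ?polyCN ?polyC1; ring.
have := congr1 (fun p : {poly int} => p`_r) genfun; rewrite coefMC coef_sum => <-.
by apply: eq_bigr => x _; rewrite coefMC coefXn eq_sym.
Qed.

(** The sum factors over coordinates, with factor 2 where [x] and [y] agree and 1 - 1 = 0 where they
    differ. *)
Lemma hchar_ortho n (x y : n.-tuple bool) :
  \sum_u hchar u x * hchar u y = ((x == y) * 2 ^ n)%:R.
Proof.
under eq_bigr do rewrite -big_split /=.
rewrite (sum_tuple_prod (fun i b => (-1) ^+ (b && tnth x i) * (-1) ^+ (b && tnth y i))) /=.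
have [->|xy] := eqVneq x y.
  rewrite mul1n natrX -[n in RHS]card_ord -prodr_const.
  by apply: eq_bigr => i _; case: (tnth _ _).
have /existsP[i xyi] : [exists i, tnth x i != tnth y i].
  apply: contraNT xy => /existsPn h; apply/eqP/eq_from_tnth => i.
  by have := h i; rewrite negbK => /eqP.
rewrite (bigD1 i) //=; move: xyi.
by case: (tnth _ _); case: (tnth _ _) => //= _; rewrite mul0r.
Qed.

Lemma hchar_nseq n (u : n.-tuple bool) b :
  hchar u [tuple of nseq n b] = (-1) ^+ (b * hweight u).
Proof.
rewrite /hchar /hweight big_distrr /= -prodrXr; apply: eq_bigr => i _.
by rewrite tnth_nseq -mulnb mulnC.
Qed.

(** The orthogonal projection onto the line spanned by the character of [u]. *)
Definition hproj (K : numFieldType) n (u : n.-tuple bool) :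
    'M[K]_#|{: n.-tuple bool}| :=
  \matrix_(i, j) ((2 ^ n)%:R^-1 * (hchar u (enum_val i) * hchar u (enum_val j))%:~R).

Lemma sum_hproj (K : numFieldType) n : \sum_u hproj K (n := n) u = 1%:M.
Proof.
apply/matrixP => i j; rewrite summxE !mxE.
under eq_bigr do rewrite mxE.
rewrite -mulr_sumr -rmorph_sum hchar_ortho (inj_eq enum_val_inj) /=.
by rewrite natz -pmulrn natrM mulrCA mulVf ?mulr1 //.
Qed.

Lemma adjmx_hproj (K : numFieldType) n r (u : n.-tuple bool) :
  adjmx K (@hamming_graph n r) *m hproj K u =
  (krawtchouk n r (hweight u))%:~R *: hproj K u.
Proof.
apply/matrixP => i j; rewrite !mxE [RHS]mulrCA -intrM mulrA -hchar_eigen.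
rewrite mulr_suml rmorph_sum mulr_sumr /=.
rewrite [RHS](reindex_onto enum_val enum_rank) /=; last by move=> x _; rewrite enum_rankK.
rewrite [RHS](eq_bigl xpredT) => [|l]; last by rewrite enum_valK eqxx.
apply: eq_bigr => l _; rewrite !mxE /= mulrCA -mulrA [in RHS]intrM.
by rewrite rmorph_nat.
Qed.

(** Passing from the all-zeros to the all-ones vertex multiplies each spectral component by the sign
    given by the parity of the weight of [u]. *)
Lemma hproj_nseq (K : numFieldType) n (u : n.-tuple bool) b :
  hproj K u *m std_basis K [tuple of nseq n b] =
  (-1) ^+ (b * hweight u) *: (hproj K u *m std_basis K [tuple of nseq n false]).
Proof.
have colE (c : bool) : hproj K u *m std_basis K [tuple of nseq n c] =
    col (enum_rank [tuple of nseq n c]) (hproj K u) by rewrite colE.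
rewrite !colE; apply/matrixP => i j; rewrite !mxE !enum_rankK !hchar_nseq.
by rewrite mul0n expr0 mulr1 intrM rmorphXn rmorphN1 mulrA mulrC.
Qed.

(** * Matrix and complex exponentials *)

Local Open Scope classical_set_scope.

Lemma mulmx_expr_eigen (K : numFieldType) m (M E : 'M[K]_m) (l : K) :
  M *m E = l *: E -> forall k, M ^+ k *m E = l ^+ k *: E.
Proof.
move=> ME; elim=> [|k IH]; first by rewrite !expr0 mul1mx scale1r.
by rewrite exprSr -mulmxA ME -scalemxAr IH scalerA -exprS.
Qed.

(** Since [M] acts on each [E i] as a scalar, inserting the resolution of the identity turns the
    partial sums into combinations of scalar series. *)
Lemma expmx_spectral (K : numFieldType) m (I : finType) (M : 'M[K]_m)
    (E : I -> 'M[K]_m) (l ex : I -> K) :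
  \sum_i E i = 1%:M -> (forall i, M *m E i = l i *: E i) ->
  (forall i, series (fun k => k`!%:R^-1 * l i ^+ k) @ \oo --> ex i) ->
  expmx M = \sum_i ex i *: E i.
Proof.
move=> E1 ME cvgl; apply/cvg_lim; first exact: norm_hausdorff.
have -> : series (fun k => k`!%:R^-1 *: M ^+ k) =
    (fun N => \sum_i series (fun k => k`!%:R^-1 * l i ^+ k) N *: E i).
  apply/funext => N; rewrite /series /=.
  under [RHS]eq_bigr do rewrite scaler_suml.
  rewrite exchange_big /=; apply: eq_bigr => k _.
  rewrite -[M ^+ k]mulmx1 -E1 mulmx_sumr scaler_sumr; apply: eq_bigr => i _.
  by rewrite (mulmx_expr_eigen (ME i)) scalerA.
apply: cvg_big => [|i _]; first exact: add_continuous.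
by apply: cvgZr_tmp; exact: cvgl.
Qed.

Local Open Scope complex_scope.

Lemma cvg_complex (R : realType) (u v : R^nat) (a b : R) :
  u @ \oo --> a -> v @ \oo --> b ->
  (fun n => u n +i* v n : (R[i] : numFieldType)) @ \oo --> (a +i* b : (R[i] : numFieldType)).
Proof.
move=> /cvgrPdist_lt ua /cvgrPdist_lt vb; apply/cvgrPdist_lt => e e0.
(* In the order of [R[i]], a positive element is real. *)
have [eI e0R] : complex.Im e = 0 /\ 0 < complex.Re e.
  by move: e0; rewrite ltcE /= => /andP[/eqP].
have e2 : 0 < complex.Re e / 2 by rewrite divr_gt0.
near=> n.
have un : `|a - u n| < complex.Re e / 2 by near: n; exact: ua.
have vn : `|b - v n| < complex.Re e / 2 by near: n; exact: vb.
rewrite normc_def ltcE eI eqxx /=.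
apply: (@le_lt_trans _ _ (`|a - u n| + `|b - v n|)).
  rewrite -[leRHS]ger0_norm ?addr_ge0 // -sqrtr_sqr ler_sqrt ?sqr_ge0 //.
  rewrite [leRHS]sqrrD !real_normK ?num_real // lerD2r lerDl.
  by rewrite mulrn_wge0 ?mulr_ge0.
by rewrite [ltRHS]splitr ltrD.
Unshelve. all: by end_near.
Qed.

Definition cis (R : realType) (x : R) : R[i] := cos x +i* sin x.

Lemma exp_coeff_cis (R : realType) (t : R) n :
  n`!%:R^-1 * ('i * t%:C) ^+ n = cos_coeff t n +i* sin_coeff t n :> R[i].
Proof.
rewrite /cos_coeff /sin_coeff /=.
rewrite exprMn -rmorphXn -(rmorph_nat (real_complex R)) -fmorphV /=.
(* The parity split mirrors the shape of [cos_coeff] and [sin_coeff]. *)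
have -> : 'i ^+ n = ((~~ odd n)%:R * (-1) ^ n./2) +i* ((odd n)%:R * (-1) ^+ n.-1./2) :> R[i].
  rewrite -[in LHS](odd_double_half n) exprD -mul2n exprM sqr_i -exprnP.
  have -> : (-1 : R[i]) ^+ n./2 = ((-1) ^+ n./2)%:C by rewrite rmorphXn rmorphN1.
  case: (boolP (odd n)) => on /=; last by rewrite !(mul0r, mul1r).
  have -> : n.-1./2 = n./2 by case: n on => //= n; rewrite uphalf_half => /negPf ->.
  rewrite expr1; apply/eqP; rewrite eq_complex /=.
  by rewrite !(mulr1n, mulr0n, mul0r, mul1r, subr0, addr0, add0r, mulr0) oppr0 !eqxx.
apply/eqP; rewrite eq_complex /= !(mul0r, mulr0, subr0, addr0, add0r).
by apply/andP; split; apply/eqP; ring.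
Qed.

Lemma cvg_exp_cis (R : realType) (t : R) :
  series (fun k => k`!%:R^-1 * ('i * t%:C) ^+ k : (R[i] : numFieldType)) @ \oo -->
  (cis t : (R[i] : numFieldType)).
Proof.
have -> : series (fun k => k`!%:R^-1 * ('i * t%:C) ^+ k : (R[i] : numFieldType)) =
  (fun n => series (cos_coeff t) n +i* series (sin_coeff t) n).
  apply/funext; elim=> [|n IH]; first by rewrite /series /= !big_geq.
  by rewrite !seriesSr IH exp_coeff_cis.
rewrite /cis cos.unlock sin.unlock.
by apply: cvg_complex; [exact: is_cvg_series_cos_coeff|exact: is_cvg_series_sin_coeff].
Qed.

Lemma cisD (R : realType) (x y : R) : cis (x + y) = cis x * cis y.
Proof.
apply/eqP; rewrite eq_complex /= cosD sinD eqxx /=.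
by apply/eqP; ring.
Qed.

Lemma norm_cis (R : realType) (x : R) : `|cis x| = 1.
Proof. by rewrite normc_def /= cos2Dsin2 sqrtr1. Qed.

Lemma cis_2pi_int (R : realType) (m : int) : cis (pi *+ 2 *~ m : R) = 1.
Proof.
have cisn (n : nat) : cis (pi *+ 2 *+ n : R) = 1.
  elim: n => [|n IH]; first by rewrite mulr0n /cis cos0 sin0.
  by rewrite mulrS cisD IH mulr1 /cis cos2pi sin2pi.
case: m => n; first exact: cisn.
rewrite NegzE mulrNz -[LHS]mulr1 -[X in _ * X](cisn n.+1) -cisD addNr.
by rewrite /cis cos0 sin0.
Qed.

(** Squaring avoids deciding between i and -i, which depends on the parity of [q]. *)
Lemma sqr_cis_odd_pihalf (R : realType) (q : int) :
  cis (pi / 2 * (2 * q + 1)%:~R : R) ^+ 2 = -1.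
Proof.
rewrite expr2 -cisD.
have -> : pi / 2 * (2 * q + 1)%:~R + pi / 2 * (2 * q + 1)%:~R = pi + pi *+ 2 *~ q :> R.
  by rewrite -[pi *+ 2 *~ q]mulrzr rmorphD rmorphM /=; field.
rewrite cisD cis_2pi_int mulr1 /cis cospi sinpi.
by apply/eqP; rewrite eq_complex /= oppr0 !eqxx.
Qed.

(** Such a [w] is i or -i, and (1 + i) / 2 and (1 - i) / 2 both have modulus sqrt 2 / 2. *)
Lemma norm_half_1D (R : realType) (w : R[i]) : w ^+ 2 = -1 ->
  `|(1 + w) / 2| = (1 / Num.sqrt 2)%:C.
Proof.
move=> w2; have : (w - 'i) * (w + 'i) == 0.
  by rewrite -subr_sqr w2 sqr_i subrr.
have s2 : Num.sqrt 2 / 2 = 1 / Num.sqrt 2 :> R.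
  have s0 : Num.sqrt 2 != 0 :> R by rewrite sqrtr_eq0 -ltNge.
  by apply: (mulIf s0); rewrite mulfVK // mulrAC -expr2 sqr_sqrtr // divff.
rewrite normrM normfV normr_nat mulf_eq0 => /orP[|].
  rewrite subr_eq0 => /eqP ->; rewrite normc_def /= addr0 add0r !expr1n -s2.
  by rewrite rmorphM fmorphV rmorph_nat.
rewrite addr_eq0 => /eqP ->; rewrite normc_def /= oppr0 addr0 add0r sqrrN !expr1n -s2.
by rewrite rmorphM fmorphV rmorph_nat.
Qed.

(** * Fractional revival from the two phases *)

Lemma transition_hamming (R : realType) n r (t : R) :
  transition_mx (@hamming_graph n r) t =
  \sum_u cis (- (t * (krawtchouk n r (hweight u))%:~R)) *: hproj R[i] u.
Proof.
apply: expmx_spectral => [|u|u]; first exact: sum_hproj.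
  by rewrite -scalemxAl adjmx_hproj scalerA.
have -> : - ('i * t%:C) * (krawtchouk n r (hweight u))%:~R =
    'i * (- (t * (krawtchouk n r (hweight u))%:~R))%:C :> R[i].
  by rewrite rmorphN rmorphM rmorph_int mulrN mulNr mulrA.
exact: cvg_exp_cis.
Qed.

Lemma hamming_revival (R : realType) n r (t : R) (x0 x1 : R[i]) : (0 < n)%N ->
  `|x0| = 1 -> x1 ^+ 2 = - x0 ^+ 2 ->
  (forall s, (s <= n)%N ->
    cis (- (t * (krawtchouk n r s)%:~R)) = if odd s then x1 else x0) ->
  balanced_fractional_revival (@hamming_graph n r) t.
Proof.
move=> n0 x0n x01 phase.
have x0u : x0 != 0 by rewrite -normr_eq0 x0n oner_eq0.
have w2 : (x1 / x0) ^+ 2 = -1 by rewrite expr_div_n x01 mulNr divff // expf_neq0.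
(* The coefficients solve alpha + beta = [x0] and alpha - beta = [x1], the conditions on characters
   of even and odd weight. *)
exists [tuple of nseq n false], [tuple of nseq n true],
  ((x0 + x1) / 2), ((x0 - x1) / 2); split.
- apply/eqP => /(congr1 (fun x => tnth x (Ordinal n0))).
  by rewrite !tnth_nseq.
- rewrite -(norm_half_1D w2) -[RHS]mul1r -[X in _ = X * _]x0n -normrM.
  by congr `| _ |; field.
- have w2N : (- (x1 / x0)) ^+ 2 = -1 by rewrite sqrrN.
  rewrite -(norm_half_1D w2N) -[RHS]mul1r -[X in _ = X * _]x0n -normrM.
  by congr `| _ |; field.
rewrite transition_hamming.
set ea := std_basis _ [tuple of nseq n false].
set eb := std_basis _ [tuple of nseq n true].
rewrite -[ea in X in _ = X + _]mul1mx -[eb in RHS]mul1mx -sum_hproj !mulmx_suml !scaler_sumr.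
rewrite -big_split /=; apply: eq_bigr => u _.
rewrite -scalemxAl phase ?hweight_le // (hproj_nseq _ u true) mul1n scalerA -scalerDl.
congr (_ *: _); rewrite -signr_odd.
by case: odd; rewrite ?expr1 ?expr0; field.
Qed.

Theorem proposition4p14 (R : realType) (k n r : nat)
    (hk : (4 <= k)%N)
    (hn : n = ((2 ^ (k - 1) + 1) * 2 ^ (k + 2) + 3)%N)
    (hr : r = (2 ^ (k + 3) + 3)%N) :
  balanced_fractional_revival (@hamming_graph n r) (pi / 2 ^+ k : R).
Proof.
set t : R := pi / 2 ^+ k; set K := krawtchouk n r.
have [q Kq] := krawtchouk_diff hk hn hr.
have twok : 2 ^+ k != 0 :> R by rewrite expf_neq0 // pnatr_eq0.
apply: (@hamming_revival R n r t (cis (- (t * (K 0%N)%:~R))) (cis (- (t * (K 1%N)%:~R)))).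
- by rewrite hn addn3.
- exact: norm_cis.
(* Since [t * 2 ^ (k - 1)] is [pi / 2], the two phases differ by an odd multiple of a quarter
   turn. *)
- have -> : - (t * (K 1%N)%:~R) = - (t * (K 0%N)%:~R) + pi / 2 * (2 * q + 1)%:~R :> R.
    have -> : K 1%N = K 0%N - (2 ^ (k - 1))%:Z * (2 * q + 1).
      by rewrite /K -Kq; ring.
    rewrite intrB intrM -[(2 ^ (k - 1))%:Z]natz rmorph_nat natrX.
    have k1 : (2 : R) ^+ k = 2 * 2 ^+ (k - 1) by rewrite -exprS; congr (_ ^+ _); lia.
    by move: twok; rewrite /t k1 mulf_eq0 negb_or => /andP[_ tk]; field.
  by rewrite cisD exprMn sqr_cis_odd_pihalf mulrN1.
move=> s sn.
have : ((2 ^ k.+1)%:Z %| K s - K (s %% 2)%N)%Z.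
  exact: krawtchouk_parity hk hn hr sn.
move=> /dvdzP[m Km].
(* As [t * 2 ^ k.+1] is [2 * pi], the congruence modulo [2 ^ k.+1] becomes a whole number of
   turns. *)
have -> : - (t * (krawtchouk n r s)%:~R) =
    - (t * (K (s %% 2)%N)%:~R) + pi *+ 2 *~ (- m) :> R.
  rewrite -/(K s) -[K s](subrK (K (s %% 2)%N)) Km -[pi *+ 2 *~ _]mulrzr.
  rewrite rmorphD rmorphM rmorphN /= -[(2 ^ k.+1)%:Z]natz rmorph_nat natrX exprS.
  by rewrite /t; field.
by rewrite cisD cis_2pi_int mulr1 modn2; case: odd.
Qed.
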